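(* Let $n\ge 3$, let $G$ be the ring (cycle) graph with vertex set $V=\{1,2,\dots,n\}$, where $j$ is adjacent to $j+1$ (indices modulo $n$), and let $|G\rangle$ be the associated ring cluster state. Then the maximum spectral gap of verification operators of $|G\rangle$ based on $X$ and $Z$ measurements is $1/2$. Moreover, if $n$ is odd, define $B_j=\{j,j+2,j+4,\dots,j+n-3\}$ (indices modulo $n$, with values in $V$) for $j=1,\dots,n$ and $B_{n+1}=V$; then the verification operator $$\Omega=\frac{1}{n+1}\sum_{j=1}^{n+1}P_{B_j}$$ satisfies $\nu(\Omega)=1/2$, where $P_B$ is the canonical test projector based on measuring $X$ on all qubits in $B$ and $Z$ on all qubits in $V\setminus B$.
   Context: The graph state $|G\rangle\in(\mathbb{C}^2)^{\otimes n}$ of a simple graph $G=(V,E)$ with $V=\{1,\dots,n\}$ is the unique (up to phase) unit vector that is a common $+1$ eigenvector of $S_j=X_j\prod_{k:\{j,k\}\in E}Z_k$, $j=1,\dots,n$, where $X_j,Z_j$ are Pauli matrices acting on qubit $j$. A test operator for $|G\rangle$ is an operator $E$ with $0\le E\le \mathbb{1}$ and $E|G\rangle=|G\rangle$; a verification operator is a finite convex combination $\Omega=\sum_kp_kE_k$ of test operators. $\beta(\Omega)$ is the second largest eigenvalue of $\Omega$ (counted with multiplicity; the largest is $1$, attained at $|G\rangle$), and $\nu(\Omega)=1-\beta(\Omega)$ is the spectral gap. For $B\subseteq V$, the setting $B$ measures $X$ on the qubits in $B$ and $Z$ on the qubits in $V\setminus B$; its outcome projectors $\Pi_{B,\mathbf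 v}$, $\mathbf v\in\{0,1\}^n$, are tensor products of projectors onto the eigenvectors with eigenvalue $(-1)^{v_j}$ of the Pauli operators measured on qubits $j=1,\dots,n$. A verification operator is based on $X$ and $Z$ measurements if each $E_k$ is a test operator that is a linear combination of the $\Pi_{B,\mathbf v}$ for some setting $B=B(k)$. The canonical test projector of setting $B$ is $P_B=\sum_{\mathbf v:\langle G|\Pi_{B,\mathbf v}|G\rangle>0}\Pi_{B,\mathbf v}$. *)

(* Defs.v *)
(* The field of complex numbers is R[i] for R : realType. *)
From HB Require Import structures.
From mathcomp Require Import all_boot all_order all_algebra.
From mathcomp Require Import reals complex.

Set Implicit Arguments.
Unset Strict Implicit.
Unset Printing Implicit Defensive.

Import Order.TTheory GRing.Theory Num.Theory.

Local Open Scope ring_scope.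
Local Open Scope sesquilinear_scope.

(* The space (C^2)^(tensor n) is C^N with N = 2^n, the coordinates being indexed
   by the bit strings through bits_of. *)
Notation bits n := {ffun 'I_n -> 'I_2}.

Definition qdim (n : nat) : nat := #|{: bits n}|.

Lemma qdimE n : qdim n = (2 ^ n)%N.
Proof. by rewrite /qdim card_ffun !card_ord. Qed.

Definition bits_of (n : nat) (a : 'I_(qdim n)) : bits n := enum_val a.

Section Qubits.
Variables (C : numClosedFieldType) (n : nat).

Definition tensor (A : 'I_n -> 'M[C]_2) : 'M[C]_(qdim n) :=
  \matrix_(a, b) \prod_(j < n) A j (bits_of a j) (bits_of b j).

Definition pauliX : 'M[C]_2 := \matrix_(a, b) (a != b)%:R.

Definition pauliZ : 'M[C]_2 := \matrix_(a, b) ((-1) ^+ a *+ (a == b)).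

Definition on_qubit (j : 'I_n) (A : 'M[C]_2) : 'M[C]_(qdim n) :=
  tensor (fun i => if i == j then A else 1%:M).

Definition stabilizer (e : rel 'I_n) (j : 'I_n) : 'M[C]_(qdim n) :=
  on_qubit j pauliX *m \big[mulmx/1%:M]_(k | e j k) on_qubit k pauliZ.

(* The vectors representing the graph state of e; they differ only by a phase. *)
Definition graph_state (e : rel 'I_n) (psi : 'cV[C]_(qdim n)) : Prop :=
  psi ^t* *m psi = 1%:M /\ forall j, stabilizer e j *m psi = psi.

Definition expval (psi : 'cV[C]_(qdim n)) (A : 'M[C]_(qdim n)) : C :=
  (psi ^t* *m A *m psi) 0 0.

(* On a complex space, this condition forces A to be Hermitian: 0 <= z
   in C implies that z is real. *)
Definition psd (A : 'M[C]_(qdim n)) : Prop := forall u, 0 <= expval u A.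

Definition test_operator (psi : 'cV[C]_(qdim n)) (E : 'M[C]_(qdim n)) : Prop :=
  [/\ psd E, psd (1%:M - E) & E *m psi = psi].

(* Normalized eigenvectors of pauliX and pauliZ for the eigenvalue (-1) ^+ v. *)
Definition eigX (v : 'I_2) : 'cV[C]_2 := \col_a ((-1) ^+ (v * a) / sqrtC 2).

Definition eigZ (v : 'I_2) : 'cV[C]_2 := delta_mx v 0.

Lemma eigX_eigen v : pauliX *m eigX v = (-1) ^+ v *: eigX v.
Proof.
apply/matrixP=> i j; rewrite !mxE !big_ord_recl big_ord0 !mxE /=.
case: v => [[|[|//]] ?]; case: i => [[|[|//]] ?] /=;
  by rewrite ?(expr0, expr1, mul0r, mul1r, addr0, add0r, mulN1r, opprK).
Qed.

Lemma eigX_norm v : (eigX v) ^t* *m eigX v = 1%:M.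
Proof.
apply/matrixP=> i j; rewrite !ord1 !mxE !big_ord_recl big_ord0 !mxE /=.
have s2 : (sqrtC 2 : C) \is Num.real by rewrite realE sqrtC_ge0 ler0n.
have K x : x \is Num.real -> (x / sqrtC 2)^* * (x / sqrtC 2) = x ^+ 2 / 2 :> C.
  move=> xr; rewrite (CrealP _) ?rpredM ?realV //.
  by rewrite -expr2 expr_div_n sqrtCK.
rewrite !K ?rpredX ?rpredN ?rpred1 //.
by rewrite -!exprM ![(_ * 2)%N]mulnC !exprM sqrrN !expr1n addr0 -splitr.
Qed.

Lemma eigZ_eigen v : pauliZ *m eigZ v = (-1) ^+ v *: eigZ v.
Proof.
apply/matrixP=> i j; rewrite !mxE (bigD1 v) //= big1 => [|k kv].
  by rewrite !mxE !eqxx !ord1 /= mulr1 addr0; case: eqP => [->|]; rewrite ?mulr1 ?mulr0.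
by rewrite !mxE (negbTE kv) mulr0.
Qed.

Lemma eigZ_norm v : (eigZ v) ^t* *m eigZ v = 1%:M.
Proof.
apply/matrixP=> i j; rewrite !ord1 !mxE (bigD1 v) //= big1 => [|k kv].
  by rewrite !mxE !eqxx conjC1 mulr1 addr0.
by rewrite !mxE (negbTE kv) mulr0.
Qed.

Definition ketbra (u : 'cV[C]_2) : 'M[C]_2 := u *m u ^t*.

(* Outcome v of the setting B: X is measured on B and Z outside B. *)
Definition outcome (B : {set 'I_n}) (v : bits n) : 'M[C]_(qdim n) :=
  tensor (fun j => ketbra (if j \in B then eigX (v j) else eigZ (v j))).

Definition setting_operator (B : {set 'I_n}) (E : 'M[C]_(qdim n)) : Prop :=
  exists c : bits n -> C, E = \sum_v c v *: outcome B v.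

Definition canonical_test (psi : 'cV[C]_(qdim n)) (B : {set 'I_n}) :
    'M[C]_(qdim n) :=
  \sum_(v | 0 < expval psi (outcome B v)) outcome B v.

(* The roots of the characteristic polynomial, with multiplicity. *)
Definition spectrum (A : 'M[C]_(qdim n)) : seq C :=
  sval (closed_field_poly_normal (char_poly A)).

Lemma spectrumE A : char_poly A = \prod_(z <- spectrum A) ('X - z%:P).
Proof.
rewrite /spectrum; case: closed_field_poly_normal => r /= {1}->.
by rewrite (monicP (char_poly_monic A)) scale1r.
Qed.

End Qubits.

Section Verification.
Variables (R : realType) (n : nat).
Local Notation C := R[i].
Local Notation op := 'M[C]_(qdim n).

Definition XZ_verification (psi : 'cV[C]_(qdim n)) (Omega : op) : Prop :=
  exists (m : nat) (p : 'I_m -> R) (E : 'I_m -> op) (B : 'I_m -> {set 'I_n}),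
    [/\ forall k, 0 <= p k,
        \sum_k p k = 1,
        forall k, test_operator psi (E k) /\ setting_operator (B k) (E k)
      & Omega = \sum_k (p k)%:C%C *: E k].

(* Re only serves to sort in R: the spectrum of a verification operator,
   being Hermitian, is real. *)
Definition beta (Omega : op) : R :=
  nth 0 (sort >=%R [seq complex.Re z | z <- spectrum Omega]) 1.

Definition nu (Omega : op) : R := 1 - beta Omega.

End Verification.

(* Vertices are numbered from 0: j : 'I_n stands for the vertex j + 1. *)
Definition ring_graph (n : nat) : rel 'I_n :=
  fun i j => (j == ordS i) || (i == ordS j).

(* {j, j + 2, j + 4, ..., j + n - 3} modulo n; used for odd n >= 3 only. *)
Definition ring_setting (n : nat) (j : 'I_n) : {set 'I_n} :=
  [set i : 'I_n | [exists k : 'I_n,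
     (k.*2 <= n - 3)%N && (i == j + k.*2 %[mod n])%N]].

Definition ring_verification (R : realType) (n : nat)
    (psi : 'cV[R[i]]_(qdim n)) : 'M[R[i]]_(qdim n) :=
  (n.+1%:R)^-1 *:
    (\sum_(j < n) canonical_test psi (ring_setting j) + canonical_test psi setT).

(* Main.v *)
(* Write Z^w for the product of the Z_i over i in w. The vectors Z^w |G> form an
   orthonormal basis, S_j having eigenvalue -1 on Z^w |G> when j is in w and +1
   otherwise.

   Upper bound: a test of the setting B commutes with X_j if j is in B, and with
   Z_j otherwise, hence fixes X_j |G> or Z_j |G>. Both vectors are orthogonal to
   |G>, as X_j |G> is the product of the Z_k |G> over the neighbours k of j. On one
   of them every verification operator therefore has expectation at least 1/2.

   Attainment: P_B kills Z^w |G> as soon as some product of stabilizers measurable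
   in B has eigenvalue -1 on it. This is the case if w meets B and B is independent,
   or if B = V and w has odd cardinality, the product of all the X_j being up to sign
   the product of all the S_j. If every nonempty w is rejected in this way by at
   least half of the settings, then the uniform mixture of their canonical tests
   has expectation at most 1/2 on every unit vector orthogonal to |G>. For n even
   the even and the odd vertices suffice. For n odd each vertex lies in (n-1)/2 of
   the B_j, two distinct vertices together meet at least (n+1)/2 of them, and V
   rejects the sets w of odd cardinality. *)
Require Import Defs.
From HB Require Import structures.
From mathcomp Require Import all_boot all_order all_algebra.
From mathcomp Require Import reals complex.
From mathcomp Require Import zify.

Set Implicit Arguments.
Unset Strict Implicit.
Unset Printing Implicit Defensive.

Import Order.TTheory GRing.Theory Num.Theory.

Local Open Scope ring_scope.
Local Open Scope sesquilinear_scope.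

(** * Inner product *)

Section InnerProduct.
Variables (C : numClosedFieldType) (N : nat).
Implicit Types (u v w : 'cV[C]_N) (A B P : 'M[C]_N).

Definition ip u v : C := (u ^t* *m v) 0 0.

Lemma adjmxM m k l (A : 'M[C]_(m, k)) (B : 'M[C]_(k, l)) :
  (A *m B) ^t* = B ^t* *m A ^t*.
Proof. by rewrite trmx_mul map_mxM. Qed.

Lemma adjmxD m k (A B : 'M[C]_(m, k)) : (A + B) ^t* = A ^t* + B ^t*.
Proof. by rewrite linearD /= map_mxD. Qed.

Lemma adjmxB m k (A B : 'M[C]_(m, k)) : (A - B) ^t* = A ^t* - B ^t*.
Proof. by rewrite linearB /= map_mxB. Qed.

Lemma adjmxZ m k a (A : 'M[C]_(m, k)) : (a *: A) ^t* = a^* *: A ^t*.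
Proof. by rewrite linearZ /= map_mxZ. Qed.

Lemma adjmx1 : (1%:M : 'M[C]_N) ^t* = 1%:M.
Proof. by rewrite trmx1 map_mx1. Qed.

Lemma adjmx_sum (I : finType) (Q : pred I) (F : I -> 'M[C]_N) :
  (\sum_(i | Q i) F i) ^t* = \sum_(i | Q i) (F i) ^t*.
Proof. by rewrite linear_sum map_mx_sum. Qed.

Lemma ipE u v : ip u v = \sum_i (u i 0)^* * v i 0.
Proof. by rewrite /ip mxE; apply: eq_bigr => i _; rewrite !mxE. Qed.

Lemma ipC u v : ip v u = (ip u v)^*.
Proof.
rewrite !ipE rmorph_sum; apply: eq_bigr => i _.
by rewrite rmorphM /= conjCK mulrC.
Qed.

Lemma ipDr u v w : ip u (v + w) = ip u v + ip u w.
Proof. by rewrite /ip mulmxDr mxE. Qed.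

Lemma ipDl u v w : ip (v + w) u = ip v u + ip w u.
Proof. by rewrite /ip adjmxD mulmxDl mxE. Qed.

Lemma ipBr u v w : ip u (v - w) = ip u v - ip u w.
Proof. by rewrite /ip mulmxBr !mxE. Qed.

Lemma ipZr a u v : ip u (a *: v) = a * ip u v.
Proof. by rewrite /ip -scalemxAr mxE. Qed.

Lemma ipZl a u v : ip (a *: u) v = a^* * ip u v.
Proof. by rewrite /ip adjmxZ -scalemxAl mxE. Qed.

Lemma ip0r u : ip u 0 = 0.
Proof. by rewrite /ip mulmx0 mxE. Qed.

Lemma ip_sumr (I : finType) (Q : pred I) (F : I -> 'cV[C]_N) u :
  ip u (\sum_(i | Q i) F i) = \sum_(i | Q i) ip u (F i).
Proof. by rewrite /ip mulmx_sumr summxE. Qed.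

Lemma ip_adj A u v : ip u (A *m v) = ip (A ^t* *m u) v.
Proof. by rewrite /ip adjmxM trmxCK mulmxA. Qed.

Lemma ip_norm u : ip u u = \sum_i `|u i 0| ^+ 2.
Proof. by rewrite ipE; apply: eq_bigr => i _; rewrite normCKC. Qed.

Lemma ip_ge0 u : 0 <= ip u u.
Proof. by rewrite ip_norm sumr_ge0 // => i _; rewrite exprn_ge0. Qed.

Lemma ip_eq0 u : ip u u = 0 -> u = 0.
Proof.
rewrite ip_norm => /psumr_eq0P u0; apply/matrixP => i j; rewrite ord1 mxE.
apply/eqP; rewrite -normr_eq0 -sqrf_eq0 u0 // => k _.
by rewrite exprn_ge0.
Qed.

Lemma unitary_ip P u v : P ^t* *m P = 1%:M -> ip (P *m u) (P *m v) = ip u v.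
Proof. by move=> PP; rewrite ip_adj mulmxA PP mul1mx. Qed.

Lemma sign_eigen_orthogonal A u v :
  A ^t* = A -> A *m u = u -> A *m v = - v -> ip u v = 0.
Proof.
move=> hA Au Av; have := ip_adj A u v; rewrite hA Au Av.
rewrite -scaleN1r ipZr mulN1r => /eqP.
by rewrite eq_sym -addr_eq0 -mulr2n mulrn_eq0 /= => /eqP.
Qed.

(** A dimension count: one linear equation in two unknowns. It serves to pick, in a plane, a nonzero
    vector orthogonal to a given one. *)
Lemma orthogonal_combination (a b : C) :
  exists xy : C * C, [&& (xy.1 != 0) || (xy.2 != 0) & xy.1 * a + xy.2 * b == 0].
Proof.
have [->|a0] := eqVneq a 0.
  by exists (1, 0); rewrite /= oner_eq0 mulr0 mul0r addr0 eqxx.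
by exists (b, - a); rewrite /= oppr_eq0 a0 orbT mulNr mulrC subrr eqxx.
Qed.

Lemma ip_combination x y u v : ip u u = 1 -> ip v v = 1 -> ip u v = 0 ->
  ip (x *: u + y *: v) (x *: u + y *: v) = `|x| ^+ 2 + `|y| ^+ 2.
Proof.
move=> uu vv uv; have vu : ip v u = 0 by rewrite ipC uv conjC0.
rewrite !ipDr !ipDl !ipZr !ipZl uu vv uv vu !mulr1 !mulr0 addr0 add0r.
by rewrite !normCK.
Qed.

Lemma normsq_pair_gt0 (x y : C) :
  (x != 0) || (y != 0) -> 0 < `|x| ^+ 2 + `|y| ^+ 2.
Proof.
move=> h; rewrite lt_def addr_ge0 ?exprn_ge0 // andbT.
by rewrite paddr_eq0 ?exprn_ge0 // !sqrf_eq0 !normr_eq0 negb_and.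
Qed.

End InnerProduct.

(** * Positive operators and projectors *)

Section Hermitian.
Variables (C : numClosedFieldType) (n : nat).
Local Notation N := (qdim n).
Implicit Types (u v : 'cV[C]_N) (A P : 'M[C]_N).

Lemma expvalE u A : expval u A = ip u (A *m u).
Proof. by rewrite /expval /ip mulmxA. Qed.

(** Polarization: expanding at [u + w] makes the form antisymmetric, and replacing [v] by ['i *: v]
    makes it symmetric as well, so it vanishes. The entries are its values on basis vectors. *)
Lemma ip_diag_eq0 A : (forall u, ip u (A *m u) = 0) -> A = 0.
Proof.
move=> h.
have h2 u v : ip u (A *m v) = 0.
  have skew w : ip u (A *m w) = - ip w (A *m u).
    have := h (u + w); rewrite mulmxDr ipDr !ipDl !h add0r addr0 addrC.
    by move/eqP; rewrite addr_eq0 => /eqP.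
  have := skew ('i *: v); rewrite -scalemxAr ipZr ipZl conjCi mulNr opprK.
  move/(mulfI (neq0Ci C)); rewrite {1}skew => /eqP.
  by rewrite eq_sym -addr_eq0 -mulr2n mulrn_eq0 /= skew => /eqP->; rewrite oppr0.
apply/matrixP => i j; have := h2 (delta_mx i 0) (delta_mx j 0).
rewrite ipE (bigD1 i) //= big1 => [|k ki]; last first.
  by rewrite mxE (negbTE ki) conjC0 mul0r.
rewrite !mxE !eqxx conjC1 mul1r addr0 (bigD1 j) //= big1 => [|k kj].
  by rewrite !mxE !eqxx mulr1 addr0.
by rewrite mxE (negbTE kj) mulr0.
Qed.

Lemma psd_hermitian A : psd A -> A ^t* = A.
Proof.
move=> pA; apply/eqP; rewrite -subr_eq0; apply/eqP/ip_diag_eq0 => u.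
rewrite mulmxBl ipBr ip_adj trmxCK ipC -expvalE.
by apply/eqP; rewrite subr_eq0; apply/eqP/CrealP/ger0_real/pA.
Qed.

Definition hproj P := P ^t* = P /\ P *m P = P.

Lemma hproj_expval P u : hproj P -> expval u P = ip (P *m u) (P *m u).
Proof. by case=> h pp; rewrite expvalE -{1}pp -mulmxA ip_adj h. Qed.

Lemma hproj_psd P : hproj P -> psd P.
Proof. by move=> h u; rewrite hproj_expval // ip_ge0. Qed.

Lemma hproj_compl P : hproj P -> hproj (1%:M - P).
Proof.
case=> h pp; split; first by rewrite adjmxB adjmx1 h.
by rewrite mulmxBr mulmx1 mulmxBl mul1mx pp subrr subr0.
Qed.

Lemma hproj_le P u : hproj P -> expval u P <= ip u u.
Proof.
move=> /hproj_compl/hproj_psd/(_ u).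
by rewrite !expvalE mulmxBl mul1mx ipBr subr_ge0.
Qed.

End Hermitian.

Lemma char_poly_similar (F : comNzRingType) (m : nat) (P Q A : 'M[F]_m) :
  Q *m P = 1%:M -> char_poly (Q *m A *m P) = char_poly A.
Proof.
move=> QP; rewrite /char_poly /char_poly_mx.
have QP' : map_mx polyC Q *m map_mx polyC P = 1%:M by rewrite -map_mxM QP map_mx1.
have -> : 'X%:M - map_mx polyC (Q *m A *m P) =
    map_mx polyC Q *m ('X%:M - map_mx polyC A) *m map_mx polyC P.
  rewrite mulmxBr mulmxBl !map_mxM; congr (_ - _).
  by rewrite scalar_mxC -mulmxA QP' mulmx1.
by rewrite !det_mulmx mulrAC -det_mulmx QP' det1 mul1r.
Qed.

(** * The second largest eigenvalue *)

Section SecondEigenvalue.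
Variables (R : realType) (n : nat).
Local Notation C := R[i].
Local Notation N := (qdim n).
Implicit Types (A : 'M[C]_N) (u psi phi : 'cV[C]_N) (t : R).

Lemma hermitian_diagonalization A : A ^t* = A ->
  exists (P : 'M[C]_N) (d : 'I_N -> R),
    [/\ P ^t* *m P = 1%:M, P *m P ^t* = 1%:M,
        beta A = nth 0 (sort >=%R [seq d i | i : 'I_N]) 1
      & forall u, expval u A =
          \sum_i (d i)%:C%C * `|(P *m u) i 0| ^+ 2].
Proof.
move=> hA; have hsym : A \is hermsymmx.
  by apply/is_hermitianmxP; rewrite expr0 scale1r hA.
have dreal := hermitian_spectral_diag_real hsym.
have := hsym; move=> /hermitian_normalmx/orthomx_spectralP.
have /unitarymxP PP := spectral_unitarymx A.
have PU := spectral_unit A.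
rewrite invmx_unitary ?spectral_unitarymx //.
move: (spectralmx A) (spectral_diag A) dreal PP PU => P D Dr PP PU AE.
have PP' := mulmx1C PP.
pose d i : R := complex.Re (D 0 i).
have dE i : (d i)%:C%C = D 0 i by apply: RRe_real; apply: (mxOverP Dr).
exists P, d; split=> //; last first.
  move=> u; rewrite expvalE {1}AE -!mulmxA ip_adj trmxCK ipE.
  apply: eq_bigr => i _; rewrite mul_diag_mx [X in _ * X]mxE dE normCKC.
  by rewrite mulrCA.
rewrite /beta; congr nth; apply/perm_sortP.
- exact: ge_total.
- exact: ge_trans.
- by move=> x y; rewrite andbC; apply: le_anti.
(* Two splittings of the characteristic polynomial into linear factors agree up to order, and
   sorting erases the order. *)
have: perm_eq (spectrum A) [seq D 0 i | i : 'I_N].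
  apply/(@prod_XsubC_eq _ _ _); rewrite -spectrumE.
  rewrite AE (char_poly_similar _ PP').
  rewrite char_poly_trig; last first.
    by apply/is_trig_mxP => i j; rewrite mxE; case: eqP => // -> ; rewrite ltnn.
  rewrite big_map enumT; apply: eq_bigr => i _; by rewrite mxE eqxx.
by move/(perm_map (@complex.Re R)); rewrite -map_comp.
Qed.

Lemma count_enum (I : finType) (d : I -> R) (p : pred R) :
  count p [seq d i | i : I] = #|[pred i | p (d i)]|.
Proof. by rewrite count_map -size_filter cardE enumT. Qed.

(** With fewer than two values [nth] returns its default [0]; the hypothesis [0 <= t] excludes this
    case. *)
Lemma second_largest_gt (I : finType) (d : I -> R) t : 0 <= t ->
  t < nth 0 (sort >=%R [seq d i | i : I]) 1 ->
  exists i k, [/\ t < d i, t < d k & i != k].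
Proof.
move=> t0 h; suff : (1 < #|[pred i | (t < d i)%R]|)%N.
  by case/card_gt1P => i [k [? ? ?]]; exists i, k; split.
rewrite -(count_enum d (> t)) -(permP (permEl (perm_sort >=%R _))).
have := @sort_sorted _ (>=%R : rel R) (@ge_total _ R) [seq d i | i : I].
case: (sort _ _) h => [|x [|y s]] /=; rewrite ?ltNge ?t0 // -!ltNge => ty.
by case/andP => yx _; rewrite ty (lt_le_trans ty yx).
Qed.

Lemma second_largest_lt (I : finType) (d : I -> R) t :
  nth 0 (sort >=%R [seq d i | i : I]) 1 < t ->
  {in [pred i | t <= d i] &, forall i, all_equal_to i}.
Proof.
move=> h; apply/card_le1_eqP.
rewrite -(count_enum d (>= t)) -(permP (permEl (perm_sort >=%R _))).
have := @sort_sorted _ (>=%R : rel R) (@ge_total _ R) [seq d i | i : I].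
case: (sort _ _) h => [|x [|y s]] /= yt; rewrite ?addn0 ?leq_b1 // => /andP[_].
rewrite (path_sortedE (@ge_trans _ R)) => /andP[ys _].
rewrite [t <= y]leNgt yt /= (@eq_in_count _ _ pred0) ?count_pred0 ?addn0 ?leq_b1 //.
move=> z zs /=; apply/negbTE; rewrite -ltNge; apply: le_lt_trans yt.
exact: (allP ys).
Qed.

(** Min-max argument: if two eigenvalues exceeded [t], their eigenvectors would span a plane
    containing a nonzero vector orthogonal to [psi], with expectation above [t] times its squared
    norm. *)
Lemma beta_le A psi t : A ^t* = A -> 0 <= t ->
  (forall u, ip psi u = 0 -> expval u A <= t%:C%C * ip u u) ->
  beta A <= t.
Proof.
move=> hA t0 h; have [P [d [PP PP' -> q]]] := hermitian_diagonalization hA.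
rewrite leNgt; apply/negP => /(second_largest_gt t0)[i [k [ti tk ik]]].
(* The eigenvectors: as [P *m P ^t* = 1%:M], [P] sends [e j] to the basis vector of index [j]. *)
pose e j : 'cV[C]_N := P ^t* *m delta_mx j 0.
have [[x y] /= /andP[xy0 /eqP xy]] :=
  orthogonal_combination (ip psi (e i)) (ip psi (e k)).
pose u := x *: e i + y *: e k.
have Pu : P *m u = x *: delta_mx i 0 + y *: delta_mx k 0.
  by rewrite mulmxDr -!scalemxAr !mulmxA PP' !mul1mx.
have := h u; rewrite ipDr !ipZr xy => /(_ erefl).
rewrite q -(unitary_ip _ _ PP) ip_norm Pu mulr_sumr lt_geF //.
have key j : j != i -> j != k ->
    (x *: delta_mx i 0 + y *: delta_mx k 0 : 'cV[C]_N) j 0 = 0.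
  by move=> ji jk; rewrite !mxE (negbTE ji) (negbTE jk) !mulr0 addr0.
rewrite (bigD1 i) // (bigD1 k) 1?eq_sym //= [ltRHS](bigD1 i) //=.
rewrite [X in _ < _ + X](bigD1 k) 1?eq_sym //=.
rewrite !big1 ?addr0; last 2 first.
- by move=> j /andP[ji jk]; rewrite key // normr0 expr0n mulr0.
- by move=> j /andP[ji jk]; rewrite key // normr0 expr0n mulr0.
rewrite !mxE !eqxx (negbTE ik) eq_sym (negbTE ik) /= !mulr0 !mulr1 addr0 add0r.
have le (z : C) (a : R) : t < a -> t%:C%C * `|z| ^+ 2 <= a%:C%C * `|z| ^+ 2.
  by move=> ta; rewrite ler_wpM2r ?exprn_ge0 // lecR ltW.
have lt (z : C) (a : R) : t < a -> z != 0 ->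
    t%:C%C * `|z| ^+ 2 < a%:C%C * `|z| ^+ 2.
  by move=> ta z0; rewrite ltr_pM2r ?exprn_gt0 ?normr_gt0 // ltcR.
by case/orP: xy0 => z0; [apply: ltr_leD|apply: ler_ltD]; auto.
Qed.

(** If [beta A < t], at most one eigenvalue reaches [t]. The plane of [psi] and [phi] contains a
    nonzero vector with no component along its eigenvector, hence of expectation below [t] times the
    squared norm. But the expectation is at least that on the whole plane, since the cross terms
    vanish, [A] being Hermitian and fixing [psi]. *)
Lemma beta_ge A psi phi t : A ^t* = A -> t <= 1 ->
  ip psi psi = 1 -> ip phi phi = 1 -> ip psi phi = 0 -> A *m psi = psi ->
  t%:C%C <= expval phi A -> t <= beta A.
Proof.
move=> hA t1 psi1 phi1 orth Apsi tphi.
have [P [d [PP PP' -> q]]] := hermitian_diagonalization hA.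
rewrite leNgt; apply/negP => /second_largest_lt card1.
have [i0 i0P] : exists i0, forall i, i != i0 -> d i < t.
  have [i0 ti0|none] := pickP [pred i | t <= d i].
    by exists i0 => i; apply: contraNlt => ti; apply/eqP/card1.
  (* If no eigenvalue reaches [t], any index serves as [i0]; one exists because [psi] is nonzero. *)
  have [i0 _|N0] := pickP [pred i : 'I_N | true]; last first.
    move/eqP: psi1; rewrite ipE big1 => [|i]; last by have := N0 i.
    by rewrite eq_sym oner_eq0.
  by exists i0 => i _; rewrite ltNge; apply/negP => ti; have := none i; rewrite /= ti.
have [[x y] /= /andP[xy0 /eqP xy]] :=
  orthogonal_combination ((P *m psi) i0 0) ((P *m phi) i0 0).
pose u := x *: psi + y *: phi.
have uu : ip u u = `|x| ^+ 2 + `|y| ^+ 2 by apply: ip_combination.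
have Aphi : ip psi (A *m phi) = 0 by rewrite ip_adj hA Apsi.
have uAu : expval u A = `|x| ^+ 2 + `|y| ^+ 2 * expval phi A.
  rewrite !expvalE mulmxDr -!scalemxAr Apsi.
  have h : ip phi psi = 0 by rewrite ipC orth conjC0.
  rewrite !ipDr !ipDl !ipZr !ipZl psi1 Aphi h !mulr0 addr0 add0r mulr1.
  by rewrite !normCK mulrA.
have lower : t%:C%C * ip u u <= expval u A.
  rewrite uAu uu mulrDr lerD //; last by rewrite mulrC ler_wpM2l ?exprn_ge0.
  by rewrite ler_piMl ?exprn_ge0 // (lecR t 1).
have Pu0 : (P *m u) i0 0 = 0.
  by rewrite mulmxDr -!scalemxAr mxE [X in X + _]mxE [X in _ + X]mxE.
have pos : 0 < ip u u by rewrite uu normsq_pair_gt0.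
move: lower; rewrite q -(unitary_ip _ _ PP) ip_norm mulr_sumr lt_geF //.
move: pos; rewrite -(unitary_ip _ _ PP) ip_norm => pos.
(* A nonzero coordinate cannot be the one at [i0], so it makes the comparison strict. *)
have [i nz] : exists i, (P *m u) i 0 != 0.
  apply/existsP; apply: contraTT pos => /existsPn h.
  by rewrite big1 ?ltxx // => i _; move/negPn/eqP: (h i) => ->; rewrite normr0 expr0n.
have le j : (d j)%:C%C * `|(P *m u) j 0| ^+ 2 <= t%:C%C * `|(P *m u) j 0| ^+ 2.
  have [->|ji] := eqVneq j i0; first by rewrite Pu0 normr0 expr0n !mulr0.
  by rewrite ler_wpM2r ?exprn_ge0 // lecR ltW ?i0P.
rewrite (bigD1 i) // [ltRHS](bigD1 i) //= ltr_leD //; last first.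
  by apply: ler_sum => j _; apply: le.
rewrite ltr_pM2r ?exprn_gt0 ?normr_gt0 // ltcR i0P //.
by apply: contraNneq nz => ->; rewrite Pu0.
Qed.

End SecondEigenvalue.

(** * Tensor products and Pauli operators *)

Section Tensor.
Variables (C : numClosedFieldType) (n : nat).
Implicit Types (A B : 'I_n -> 'M[C]_2).

Lemma bits_of_bij : bijective (@bits_of n).
Proof. exact: enum_val_bij. Qed.

Lemma eq_tensor A B : A =1 B -> tensor A = tensor B.
Proof.
by move=> AB; apply/matrixP => a b; rewrite !mxE; apply: eq_bigr => j _; rewrite AB.
Qed.

Lemma tensorM A B : tensor A *m tensor B = tensor (fun j => A j *m B j).
Proof.
apply/matrixP => a b; rewrite !mxE.
under [RHS]eq_bigr do rewrite mxE.
rewrite bigA_distr_bigA (reindex (@bits_of n)) /=; last exact/onW_bij/bits_of_bij.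
by apply: eq_bigr => c _; rewrite !mxE big_split.
Qed.

Lemma tensor_sum (F : 'I_n -> 'I_2 -> 'M[C]_2) :
  \sum_(v : bits n) tensor (fun j => F j (v j)) = tensor (fun j => \sum_x F j x).
Proof.
apply/matrixP => a b; rewrite summxE mxE.
under [RHS]eq_bigr do rewrite summxE.
by rewrite bigA_distr_bigA; apply: eq_bigr => v _; rewrite mxE.
Qed.

Lemma tensor_adj A : (tensor A) ^t* = tensor (fun j => (A j) ^t*).
Proof.
apply/matrixP => a b; rewrite !mxE rmorph_prod.
by apply: eq_bigr => j _; rewrite !mxE.
Qed.

Lemma tensor1 : tensor (fun _ : 'I_n => 1%:M) = 1%:M :> 'M[C]_(qdim n).
Proof.
apply/matrixP => a b; rewrite !mxE.
have [->|ab] := eqVneq a b; first by rewrite big1 // => j _; rewrite mxE eqxx.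
suff /existsP[j jab] : [exists j, bits_of a j != bits_of b j].
  by rewrite (bigD1 j) //= mxE (negbTE jab) mul0r.
apply: contraNT ab => /existsPn h; apply/eqP/(bij_inj bits_of_bij)/ffunP => j.
by apply/eqP/negPn/h.
Qed.

Lemma tensor_scale (c : 'I_n -> C) A B :
  (forall j, A j = c j *: B j) -> tensor A = (\prod_j c j) *: tensor B.
Proof.
move=> AB; apply/matrixP => a b; rewrite !mxE -big_split.
by apply: eq_bigr => j _; rewrite AB mxE.
Qed.

(** Reduces the sign between two Pauli products to a count of the qubits where the factors
    anticommute. *)
Lemma tensor_commute (c : 'I_n -> C) A B :
  (forall j, A j *m B j = c j *: (B j *m A j)) ->
  tensor A *m tensor B = (\prod_j c j) *: (tensor B *m tensor A).
Proof. by move=> AB; rewrite !tensorM; apply: tensor_scale. Qed.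

Definition on_qubits (w : {set 'I_n}) (M : 'M[C]_2) : 'M[C]_(qdim n) :=
  tensor (fun i => if i \in w then M else 1%:M).

Lemma on_qubitE j (M : 'M[C]_2) : on_qubit j M = on_qubits [set j] M.
Proof. by apply: eq_tensor => i; rewrite inE. Qed.

Lemma on_qubits0 (M : 'M[C]_2) : on_qubits set0 M = 1%:M.
Proof. by rewrite -tensor1; apply: eq_tensor => i; rewrite inE. Qed.

Lemma prod_on_qubit (p : pred 'I_n) (M : 'M[C]_2) :
  \big[mulmx/1%:M]_(k | p k) on_qubit k M = on_qubits [set k | p k] M.
Proof.
(* In this induction [uniq r] ensures that no qubit receives [M] twice. *)
have h r : uniq r -> \big[mulmx/1%:M]_(k <- r | p k) on_qubit k M =
    on_qubits [set k | (k \in r) && p k] M.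
  elim: r => [_|k r IH /= /andP[kr /IH{}IH]].
    by rewrite big_nil -(on_qubits0 M); apply: eq_tensor => i; rewrite !inE.
  rewrite big_cons IH; case: (boolP (p k)) => pk.
    rewrite on_qubitE tensorM; apply: eq_tensor => i; rewrite !inE.
    have [->|ik] := eqVneq i k; last by rewrite mul1mx.
    by rewrite (negbTE kr) pk mulmx1.
  apply: eq_tensor => i; rewrite !inE.
  by have [->|] := eqVneq i k; rewrite // (negbTE kr) (negbTE pk).
rewrite h ?index_enum_uniq //; apply: eq_tensor => i.
by rewrite !inE mem_index_enum.
Qed.

End Tensor.

(** * Single-qubit Pauli matrices *)

Section Pauli.
Variable C : numClosedFieldType.
Local Notation X := (pauliX C).
Local Notation Z := (pauliZ C).

(** The boolean stands for [j \in B]: [pauli (j \in B)] is the observable that the setting [B]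
    measures on qubit [j], which lets [X] and [Z] be treated together. *)
Definition pauli (b : bool) := if b then X else Z.

Lemma ord2_ind (P : 'I_2 -> Prop) : P 0 -> P 1 -> forall i, P i.
Proof.
move=> P0 P1 [[|[|//]] h].
  by rewrite (_ : Ordinal h = 0) //; apply: val_inj.
by rewrite (_ : Ordinal h = 1) //; apply: val_inj.
Qed.

Ltac mx2 := apply/matrixP; apply: ord2_ind; apply: ord2_ind;
  rewrite !mxE ?big_ord_recl ?big_ord0 /= ?mxE /=.

Lemma pauli_adj b : (pauli b) ^t* = pauli b.
Proof.
case: b; mx2; rewrite ?conjC_nat // ?rmorphMn /= ?rmorphXn /= ?conjC1 ?rmorphN1 //.
Qed.

Lemma pauliK b : pauli b *m pauli b = 1%:M.
Proof.
case: b; mx2;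
  by rewrite ?mulr0n ?mulr1n ?(mulr0, mul0r, mulr1, addr0, add0r, expr0, expr1, mulrNN).
Qed.

Lemma pauliXZ : X *m Z = - (Z *m X).
Proof.
mx2; by rewrite ?mulr0n ?mulr1n ?(mulr0, mul0r, mulr1, mul1r, addr0, add0r,
  expr0, expr1, mulrNN, oppr0, opprK, mulN1r).
Qed.

Lemma pauliZX : Z *m X = - (X *m Z).
Proof. by rewrite pauliXZ opprK. Qed.

Definition eig (b : bool) v : 'cV[C]_2 := if b then eigX C v else eigZ C v.

(** The spectral projector of an involution; the algebra of outcomes follows from this formula for
    [X] and [Z] alike. *)
Lemma ketbra_eig b v : ketbra (eig b v) = 2^-1 *: (1%:M + (-1) ^+ v *: pauli b).
Proof.
have K (i j : nat) : (-1) ^+ i / sqrtC 2 * ((-1) ^+ j / sqrtC 2)^* =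
    2^-1 * (-1) ^+ (i + j) :> C.
  have s2 : (sqrtC 2 : C) \is Num.real by rewrite realE sqrtC_ge0 ler0n.
  have sr : ((-1) ^+ j / sqrtC 2 : C) \is Num.real.
    by rewrite rpredM ?realV // rpredX // rpredN rpred1.
  by rewrite (CrealP sr) mulrACA -exprD -invfM -expr2 sqrtCK mulrC.
have half : 2^-1 * (1 + 1) = 1 :> C by rewrite mulVf // pnatr_eq0.
case: b; move: v; apply: ord2_ind; mx2;
  by rewrite ?(modn_small (isT : (1 < 2)%N)) ?K ?(conjC1, conjC0, mulr0, mul0r,
    mulr1n, mulr0n, expr0, expr1, mulr1, mul1r, mulrNN, addr0, add0r, subrr,
    addn0, add0n, muln0, mul0n, sqrrN, expr1n, half).
Qed.

Lemma ketbra_eig_adj b v : (ketbra (eig b v)) ^t* = ketbra (eig b v).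
Proof. by rewrite adjmxM trmxCK. Qed.

Lemma ketbra_eig_pauli b v :
  ketbra (eig b v) *m pauli b = (-1) ^+ v *: ketbra (eig b v).
Proof.
rewrite ketbra_eig -scalemxAl mulmxDl mul1mx -scalemxAl pauliK.
rewrite !scalerA mulrC -scalerA; congr (_ *: _).
by rewrite scalerDr scalerA -exprD addnn -muln2 mulnC exprM sqrrN !expr1n scale1r addrC.
Qed.

Lemma pauli_ketbra_eig b v :
  pauli b *m ketbra (eig b v) = (-1) ^+ v *: ketbra (eig b v).
Proof.
have := congr1 (fun M => M ^t*) (ketbra_eig_pauli b v).
rewrite adjmxM ketbra_eig_adj pauli_adj adjmxZ ketbra_eig_adj => ->.
by rewrite rmorphXn /= rmorphN1.
Qed.

Lemma ketbra_eigM b v w :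
  ketbra (eig b v) *m ketbra (eig b w) = (v == w)%:R *: ketbra (eig b v).
Proof.
rewrite [X in _ *m X]ketbra_eig -scalemxAr mulmxDr mulmx1 -scalemxAr.
rewrite ketbra_eig_pauli scalerA -[X in X + _]scale1r -scalerDl scalerA.
congr (_ *: _).
have half : 2^-1 * (1 + 1) = 1 :> C by rewrite mulVf // pnatr_eq0.
move: v w; apply: ord2_ind; apply: ord2_ind => /=;
  by rewrite ?(modn_small (isT : (1 < 2)%N)) ?expr0 ?expr1 ?mulrNN ?mulr1 ?mul1r
    ?subrr ?mulr0 ?half.
Qed.

Lemma sum_ketbra_eig b : \sum_v ketbra (eig b v) = 1%:M.
Proof.
rewrite !big_ord_recl big_ord0 addr0 !ketbra_eig -scalerDr /=.
rewrite /bump /= addn0 expr0 expr1 scale1r scaleN1r addrACA subrr addr0.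
by rewrite scalerDr -scalerDl -[2^-1]div1r -splitr scale1r.
Qed.

End Pauli.

(** * Measurement settings *)

Section Outcomes.
Variables (C : numClosedFieldType) (n : nat).
Local Notation N := (qdim n).
Implicit Types (B : {set 'I_n}) (v : bits n) (psi u : 'cV[C]_N).

Lemma outcomeE B v :
  outcome C B v = tensor (fun j => ketbra (eig C (j \in B) (v j))).
Proof. by []. Qed.

Lemma outcomeM B v w : outcome C B v *m outcome C B w = (v == w)%:R *: outcome C B v.
Proof.
rewrite !outcomeE tensorM.
rewrite (tensor_scale (fun j => ketbra_eigM C (j \in B) (v j) (w j))).
congr (_ *: _); have [->|vw] := eqVneq v w; first by rewrite big1 // => j; rewrite eqxx.
suff /existsP[j jvw] : [exists j, v j != w j] by rewrite (bigD1 j) //= (negbTE jvw) mul0r.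
by apply: contraNT vw => /existsPn h; apply/eqP/ffunP => j; apply/eqP/negPn/h.
Qed.

Lemma outcome_adj B v : (outcome C B v) ^t* = outcome C B v.
Proof. by rewrite !outcomeE tensor_adj; apply: eq_tensor => j; apply: ketbra_eig_adj. Qed.

Lemma outcome_hproj B v : hproj (outcome C B v).
Proof. by split; [exact: outcome_adj|rewrite outcomeM eqxx scale1r]. Qed.

Lemma sum_outcome B : \sum_v outcome C B v = 1%:M.
Proof.
rewrite (tensor_sum (fun j x => ketbra (eig C (j \in B) x))) -tensor1.
by apply: eq_tensor => j; apply: sum_ketbra_eig.
Qed.

(** Such Pauli products are diagonal in the outcomes of [B]; some qubits may be ignored. *)
Definition measurable_in B (A : 'I_n -> 'M[C]_2) :=
  forall j, A j = 1%:M \/ A j = pauli C (j \in B).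

Lemma outcome_measurable B A v : measurable_in B A ->
  exists s, outcome C B v *m tensor A = s *: outcome C B v /\
            tensor A *m outcome C B v = s *: outcome C B v.
Proof.
(* The eigenvalue is the product of the outcome signs over the qubits that [A] does not ignore. *)
move=> hA; exists (\prod_j (if A j == 1%:M then 1 else (-1) ^+ v j)).
rewrite !tensorM; split; apply: tensor_scale => j; have [->|/eqP] := eqVneq;
  rewrite ?mulmx1 ?mul1mx ?scale1r //; case: (hA j) => -> // _.
- exact: ketbra_eig_pauli.
- exact: pauli_ketbra_eig.
Qed.

Lemma outcome_possible B v psi :
  (0 < expval psi (outcome C B v)) = (outcome C B v *m psi != 0).
Proof.
rewrite (hproj_expval _ (outcome_hproj B v)) lt_def ip_ge0 andbT; congr (~~ _).
by apply/eqP/eqP => [/ip_eq0//|->]; rewrite ip0r.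
Qed.

Lemma canonical_test_hproj psi B : hproj (canonical_test psi B).
Proof.
split; first by rewrite adjmx_sum; apply: eq_bigr => v _; rewrite outcome_adj.
rewrite /canonical_test mulmx_suml; apply: eq_bigr => v hv.
rewrite mulmx_sumr (bigD1 v) //= big1 => [|w /andP[_ wv]].
  by rewrite outcomeM eqxx scale1r addr0.
by rewrite outcomeM eq_sym (negbTE wv) scale0r.
Qed.

(** The discarded outcomes annihilate [psi], and all the outcomes sum to the identity. *)
Lemma canonical_test_fix psi B : canonical_test psi B *m psi = psi.
Proof.
rewrite -[RHS]mul1mx -(sum_outcome B) !mulmx_suml big_mkcond /=.
apply: eq_bigr => v _; case: ifPn => //.
by rewrite outcome_possible negbK => /eqP.
Qed.

Lemma canonical_test_operator psi B : test_operator psi (canonical_test psi B).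
Proof.
have h := canonical_test_hproj psi B.
by split; [exact: hproj_psd|exact/hproj_psd/hproj_compl|exact: canonical_test_fix].
Qed.

Lemma canonical_setting psi B : setting_operator B (canonical_test psi B).
Proof.
exists (fun v => (0 < expval psi (outcome C B v) :> C)%R%:R).
rewrite /canonical_test big_mkcond /=; apply: eq_bigr => v _.
by case: ifP; rewrite ?scale1r ?scale0r.
Qed.

(** Both operators are diagonal with respect to the outcomes of [B]. *)
Lemma setting_operator_commute B E A : setting_operator B E ->
  measurable_in B A -> E *m tensor A = tensor A *m E.
Proof.
case=> c ->; move=> hA; rewrite mulmx_suml mulmx_sumr; apply: eq_bigr => v _.
by have [s [h1 h2]] := outcome_measurable v hA; rewrite -scalemxAl -scalemxAr h1 h2.
Qed.

(* Every possible outcome of the setting determines the outcome [c] of [tensor A]. *)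
Lemma canonical_test_reject psi B A c u : measurable_in B A -> c != 0 ->
  tensor A *m psi = c *: psi -> tensor A *m u = - (c *: u) ->
  canonical_test psi B *m u = 0.
Proof.
move=> hA c0 Apsi Au; rewrite mulmx_suml big1 // => v.
rewrite outcome_possible => /negP pv; have [s [h _]] := outcome_measurable v hA.
have sc : s = c.
  apply/eqP; rewrite -subr_eq0; apply/negPn/negP => sc0; apply: pv.
  have : (s - c) *: (outcome C B v *m psi) = 0.
    by rewrite scalerBl scalemxAl -h -mulmxA Apsi scalemxAr subrr.
  by move/eqP; rewrite scaler_eq0 (negbTE sc0).
apply/eqP; have : (c + c) *: (outcome C B v *m u) = 0.
  by rewrite scalerDl {1}scalemxAl -{1}sc -h -mulmxA Au mulmxN -scalemxAr addNr.
by move/eqP; rewrite scaler_eq0 -mulr2n mulrn_eq0 (negbTE c0).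
Qed.

End Outcomes.

(** * The graph basis *)

Section GraphBasis.
Variables (C : numClosedFieldType) (n : nat) (e : rel 'I_n).
Hypothesis e_irr : irreflexive e.
Local Notation N := (qdim n).
Local Notation X := (pauliX C).
Local Notation Z := (pauliZ C).

Definition stabilizer_factor (j i : 'I_n) : 'M[C]_2 :=
  if i == j then X else if e j i then Z else 1%:M.

(** Irreflexivity keeps the [Z] factors off qubit [j]. *)
Lemma stabilizerE j : stabilizer C e j = tensor (stabilizer_factor j).
Proof.
rewrite /stabilizer prod_on_qubit tensorM; apply: eq_tensor => i.
rewrite !inE /stabilizer_factor; have [->|ij] := eqVneq i j; last by rewrite mul1mx.
by rewrite e_irr mulmx1.
Qed.

Lemma stabilizer_adj j : (stabilizer C e j) ^t* = stabilizer C e j.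
Proof.
rewrite stabilizerE tensor_adj; apply: eq_tensor => i; rewrite /stabilizer_factor.
case: ifP => _; first exact: (pauli_adj C true).
by case: ifP => _; [exact: (pauli_adj C false)|exact: adjmx1].
Qed.

(** The [X] of the stabilizer can meet a [Z] only at qubit [j]; all the other factors commute. *)
Lemma stabilizer_Z j (w : {set 'I_n}) : stabilizer C e j *m on_qubits w Z =
  (-1) ^+ (j \in w) *: (on_qubits w Z *m stabilizer C e j).
Proof.
rewrite stabilizerE (tensor_commute (c := fun i => (-1) ^+ ((i == j) && (j \in w)))).
  congr (_ *: _); rewrite (bigD1 j) //= eqxx big1 ?mulr1 // => i /negbTE->.
  by rewrite expr0.
move=> i; rewrite /stabilizer_factor.
have [->|ij] /= := eqVneq i j; last first.
  by rewrite expr0 scale1r; case: ifP => _; case: ifP => _; rewrite ?mulmx1 ?mul1mx.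
by case: ifP => _; rewrite ?expr0 ?expr1 ?scale1r ?scaleN1r ?mulmx1 ?mul1mx // pauliXZ.
Qed.

Lemma on_qubits_unitary b (w : {set 'I_n}) :
  (on_qubits w (pauli C b)) ^t* *m on_qubits w (pauli C b) = 1%:M.
Proof.
rewrite tensor_adj tensorM -tensor1; apply: eq_tensor => i; case: ifP => _.
  by rewrite pauli_adj pauliK.
by rewrite adjmx1 mulmx1.
Qed.

Variable psi : 'cV[C]_N.
Hypothesis psiG : graph_state e psi.

Lemma ip_psi : ip psi psi = 1.
Proof. by case: psiG => h _; rewrite /ip h mxE. Qed.

Definition graph_basis (w : {set 'I_n}) : 'cV[C]_N := on_qubits w Z *m psi.

Lemma graph_basis0 : graph_basis set0 = psi.
Proof. by rewrite /graph_basis on_qubits0 mul1mx. Qed.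

Lemma stabilizer_graph_basis j w :
  stabilizer C e j *m graph_basis w = (-1) ^+ (j \in w) *: graph_basis w.
Proof.
by rewrite mulmxA stabilizer_Z -scalemxAl -mulmxA psiG.2.
Qed.

(** Distinct sets differ at some [j], and the Hermitian [stabilizer C e j] has opposite signs on the
    two vectors. *)
Lemma graph_basis_orthonormal w w' :
  ip (graph_basis w) (graph_basis w') = (w == w')%:R.
Proof.
have [->|ww'] := eqVneq w w'.
  by rewrite /graph_basis unitary_ip ?ip_psi // (on_qubits_unitary false).
have /existsP[j] : [exists j, (j \in w) != (j \in w')].
  apply: contraNT ww' => /existsPn h; apply/eqP/setP => j; exact/eqP/negPn/h.
have h := stabilizer_graph_basis j.
have O (v v' : {set 'I_n}) : (j \in v) = false -> (j \in v') ->
      ip (graph_basis v) (graph_basis v') = 0.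
  move=> jv jv'; apply: (sign_eigen_orthogonal (stabilizer_adj j)).
    by rewrite h jv expr0 scale1r.
  by rewrite h jv' expr1 scaleN1r.
case jw: (j \in w); case jw': (j \in w') => // _; last exact: O.
by rewrite ipC O // conjC0.
Qed.

(** Subsets match coordinates, so the graph basis has as many vectors as the dimension. *)
Lemma set_of_bits_bij :
  bijective (fun a : 'I_N => [set i : 'I_n | bits_of a i != 0]).
Proof.
have h : bijective (fun v : bits n => [set i : 'I_n | v i != 0]).
  exists (fun w : {set 'I_n} => [ffun i => if i \in w then 1 else 0]).
    move=> v; apply/ffunP => i; rewrite ffunE inE.
    by elim/ord2_ind: (v i).
  by move=> w; apply/setP => i; rewrite inE ffunE; case: (i \in w).
exact: (bij_comp h (@bits_of_bij n)).
Qed.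

Lemma graph_basis_expansion u :
  u = \sum_w ip (graph_basis w) u *: graph_basis w.
Proof.
pose s (a : 'I_N) := [set i : 'I_n | bits_of a i != 0].
(* The columns of [U] are the graph basis. As [U] is square, [U ^t* *m U = 1%:M] gives
   [U *m U ^t* = 1%:M], which is completeness. *)
pose U : 'M[C]_N := \matrix_(a, b) graph_basis (s b) a 0.
have UU : U ^t* *m U = 1%:M.
  apply/matrixP => a b; transitivity (ip (graph_basis (s a)) (graph_basis (s b))).
    by rewrite ipE mxE; apply: eq_bigr => k _; rewrite !mxE.
  by rewrite graph_basis_orthonormal (bij_eq set_of_bits_bij) mxE.
rewrite -{1}[u]mul1mx -(mulmx1C UU) -mulmxA.
rewrite (reindex s) /=; last exact/onW_bij/set_of_bits_bij.
apply/matrixP => a b; rewrite ord1 mxE summxE; apply: eq_bigr => k _.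
rewrite [RHS]mxE mulrC; congr (_ * _); first last.
  by rewrite mxE.
by rewrite ipE mxE; apply: eq_bigr => l _; rewrite !mxE.
Qed.

Lemma graph_basis_normsq (Q : pred {set 'I_n}) (c : {set 'I_n} -> C) :
  let u := \sum_(w | Q w) c w *: graph_basis w in
  ip u u = \sum_(w | Q w) `|c w| ^+ 2.
Proof.
rewrite /= {1}ip_sumr; apply: eq_bigr => w Qw; rewrite ipZr ipC ip_sumr.
rewrite (bigD1 w) //= big1 => [|w' /andP[_ w'w]].
  by rewrite ipZr graph_basis_orthonormal eqxx mulr1 addr0 normCK.
by rewrite ipZr graph_basis_orthonormal eq_sym (negbTE w'w) mulr0.
Qed.

(** Uniqueness of the graph state: for nonempty [w] some stabilizer has sign -1 on the vector of
    [w], so [u] has no component there. *)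
Lemma stabilized_vector u : (forall j, stabilizer C e j *m u = u) ->
  u = ip psi u *: psi.
Proof.
move=> hu; rewrite {1}(graph_basis_expansion u) (bigD1 set0) //= graph_basis0.
rewrite big1 ?addr0 // => w /set0Pn[j jw].
rewrite ipC (sign_eigen_orthogonal (stabilizer_adj j) (hu j)) ?conjC0 ?scale0r //.
by rewrite stabilizer_graph_basis jw expr1 scaleN1r.
Qed.

(** Apply [X] on qubit [j] to the equation [stabilizer C e j *m psi = psi]; the two [X] cancel. *)
Lemma X_graph_basis j : on_qubit j X *m psi = graph_basis [set k | e j k].
Proof.
have := psiG.2 j; rewrite /stabilizer prod_on_qubit -mulmxA => {1}<-.
by rewrite mulmxA on_qubitE tensorM (eq_tensor (B := fun=> 1%:M)) ?tensor1 ?mul1mx //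
  => i; case: ifP => _; rewrite ?mulmx1 // (pauliK C true).
Qed.

End GraphBasis.

(** * Verification of graph states *)

Section GraphVerification.
Variables (R : realType) (n : nat) (e : rel 'I_n).
Hypothesis e_irr : irreflexive e.
Local Notation C := R[i].
Local Notation N := (qdim n).
Variable psi : 'cV[C]_N.
Hypothesis psiG : graph_state e psi.

(** The edge makes the neighbourhood of [j] nonempty, so that [X] on qubit [j] sends [psi] to a
    graph basis vector other than [psi]. *)
Lemma XZ_nu_le_half j k (Omega : 'M[C]_N) : e j k ->
  XZ_verification psi Omega -> nu Omega <= 1 / 2.
Proof.
move=> ejk [m [p [E [B [p0 p1 tests OmegaE]]]]].
pose phi b := on_qubit j (pauli C b) *m psi.
have [w w0 phiE] : exists2 w : bool -> {set 'I_n}, forall b, w b != set0 &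
    forall b, phi b = graph_basis psi (w b).
  exists (fun b => if b then [set k | e j k] else [set j]) => -[].
  - by apply/set0Pn; exists k; rewrite inE.
  - by apply/set0Pn; exists j; rewrite inE.
  - exact: X_graph_basis.
  - by rewrite /phi on_qubitE.
have fixed i : E i *m phi (j \in B i) = phi (j \in B i).
  have [[_ _ Epsi] hset] := tests i.
  rewrite /phi mulmxA (setting_operator_commute hset) -?mulmxA ?Epsi // => l.
  by case: eqP => [->|_]; [right|left].
have Eherm i : (E i) ^t* = E i by case: (tests i) => -[/psd_hermitian].
have pE i : ((p i)%:C%C)^* = (p i)%:C%C.
  by apply/CrealP/ger0_real; rewrite lecR.
have hOmega : Omega ^t* = Omega.
  rewrite OmegaE adjmx_sum; apply: eq_bigr => i _.
  by rewrite adjmxZ Eherm pE.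
have psum : \sum_i (p i)%:C%C = 1 :> C by rewrite -rmorph_sum p1.
have Opsi : Omega *m psi = psi.
  rewrite OmegaE mulmx_suml -[RHS]scale1r -psum scaler_suml.
  by apply: eq_bigr => i _; rewrite -scalemxAl; case: (tests i) => -[_ _ ->].
have phi1 b : ip (phi b) (phi b) = 1.
  by rewrite phiE (graph_basis_orthonormal e_irr psiG) eqxx.
have phi0 b : ip psi (phi b) = 0.
  rewrite phiE -{1}(graph_basis0 psi) (graph_basis_orthonormal e_irr psiG).
  by rewrite eq_sym (negbTE (w0 b)).
have ex b : expval (phi b) Omega = \sum_i (p i)%:C%C * expval (phi b) (E i).
  rewrite expvalE OmegaE mulmx_suml ip_sumr; apply: eq_bigr => i _.
  by rewrite -scalemxAl ipZr expvalE.
have Epos b i : 0 <= expval (phi b) (E i) by case: (tests i) => -[/(_ (phi b))].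
have ex0 b : 0 <= expval (phi b) Omega.
  by rewrite ex sumr_ge0 // => i _; rewrite mulr_ge0 // lecR.
(* For each [i], one of the two expectations of [E i] is 1 and the other is nonnegative. *)
have total : 1 <= expval (phi true) Omega + expval (phi false) Omega.
  rewrite !ex -big_split -psum; apply: ler_sum => i _ /=.
  rewrite -mulrDr ler_peMr ?lecR //.
  have one : expval (phi (j \in B i)) (E i) = 1 by rewrite expvalE fixed phi1.
  by case: (j \in B i) one => ->; rewrite ?lerDl ?lerDr.
have [b hb] : exists b, (1 / 2 : R)%:C%C <= expval (phi b) Omega.
  have halfE : (1 / 2 : R)%:C%C = 1 / 2 :> C by rewrite rmorphM fmorphV rmorph_nat.
  (* The order of the complex numbers is partial, so the case distinction needs both sides real. *)
  have hr : (1 / 2 : C) \is Num.real by rewrite -halfE complex_real.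
  rewrite halfE; have [h|h] := real_leP hr (ger0_real (ex0 true)); first by exists true.
  exists false; rewrite -(lerD2l (1 / 2)) -splitr.
  by apply: le_trans total _; rewrite lerD2r ltW.
rewrite /nu lerBlDr -lerBlDl {1}[1]splitr addrK.
apply: beta_ge hOmega _ (ip_psi psiG) (phi1 b) (phi0 b) Opsi hb => //.
by rewrite ler_pdivrMr ?mul1r ?ler1n.
Qed.

Variables (K : finType) (B : K -> {set 'I_n}).
Hypothesis K_gt0 : (0 < #|K|)%N.

(** Indexing by a type, not by a set of settings, counts repeated settings with multiplicity. *)
Definition uniform_test : 'M[C]_N :=
  (#|K|%:R)^-1 *: \sum_k canonical_test psi (B k).

Lemma uniform_test_XZ : XZ_verification psi uniform_test.
Proof.
exists #|K|, (fun=> #|K|%:R^-1), (fun i => canonical_test psi (B (enum_val i))),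
  (fun i => B (enum_val i)); split.
- by move=> _; rewrite invr_ge0 ler0n.
- by rewrite sumr_const card_ord -(mulr_natl _^-1) divff // pnatr_eq0 -lt0n.
- by move=> i; split; [exact: canonical_test_operator|exact: canonical_setting].
rewrite /uniform_test (reindex (@enum_val K K)) /=; last exact/onW_bij/enum_val_bij.
by rewrite scaler_sumr; apply: eq_bigr => i _; rewrite fmorphV rmorph_nat.
Qed.

Lemma uniform_test_beta :
  (forall w, w != set0 ->
    (#|K| <= 2 * #|[pred k | canonical_test psi (B k) *m graph_basis psi w == 0%R]|)%N) ->
  beta uniform_test <= 1 / 2.
Proof.
move=> reject; pose P k := canonical_test psi (B k).
have hP k : hproj (P k) by apply: canonical_test_hproj.
apply: (beta_le (psi := psi)).
- rewrite adjmxZ adjmx_sum fmorphV rmorph_nat; congr (_ *: _).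
  by apply: eq_bigr => k _; case: (hP k).
- by rewrite divr_ge0.
move=> u orth; pose c w := ip (graph_basis psi w) u.
have c0 : c set0 = 0 by rewrite /c graph_basis0.
have uE := graph_basis_expansion e_irr psiG u.
(* Only the components not annihilated by [P k] matter, and a projector does not increase the
   norm. *)
have bound k : expval u (P k) <=
    \sum_(w | P k *m graph_basis psi w != 0) `|c w| ^+ 2.
  rewrite -(graph_basis_normsq e_irr psiG) /=.
  have Pu : P k *m u =
      P k *m \sum_(w | P k *m graph_basis psi w != 0) c w *: graph_basis psi w.
    rewrite {1}uE !mulmx_sumr [RHS]big_mkcond /=; apply: eq_bigr => w _.
    by case: ifPn => // /negPn/eqP h; rewrite -scalemxAr h scaler0.
  by rewrite (hproj_expval _ (hP k)) Pu -hproj_expval // hproj_le.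
have uu : ip u u = \sum_w `|c w| ^+ 2.
  by rewrite {1 2}uE (graph_basis_normsq e_irr psiG).
have halfE : (1 / 2 : R)%:C%C = 1 / 2 :> C by rewrite rmorphM fmorphV rmorph_nat.
rewrite expvalE -scalemxAl ipZr mulmx_suml ip_sumr halfE mulrC.
rewrite ler_pdivrMr ?ltr0n // uu mulrAC mulr_sumr.
apply: le_trans (_ : _ <= \sum_k \sum_(w | P k *m graph_basis psi w != 0) `|c w| ^+ 2) _.
  by apply: ler_sum => k _; rewrite -expvalE bound.
(* After the exchange, the weight of [w] is counted once for each test that does not annihilate its
   vector: at most half of them if [w] is nonempty. The weight of [set0] is zero by orthogonality to
   [psi]. *)
rewrite (exchange_big_dep predT) //=; apply: ler_sum => w _.
rewrite sumr_const; have [->|w0] := eqVneq w set0.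
  by rewrite c0 normr0 expr0n mul0rn mulr0.
rewrite -(mulr_natl (_ ^+ 2)) ler_wpM2r ?exprn_ge0 // mul1r mulrC ler_pdivlMr ?ltr0n //.
rewrite -natrM ler_nat.
have := reject w w0; rewrite -(cardC [pred k | P k *m graph_basis psi w == 0]).
set a := #|[pred k | P k *m graph_basis psi w == 0]|.
rewrite mul2n -addnn leq_add2l => h; rewrite muln2 -addnn leq_add2r.
exact: h.
Qed.

End GraphVerification.

(** * Basis vectors rejected by canonical tests *)

Section Rejection.
Variables (C : numClosedFieldType) (n : nat) (e : rel 'I_n).
Hypothesis e_irr : irreflexive e.
Variable psi : 'cV[C]_(qdim n).
Hypothesis psiG : graph_state e psi.

(** The neighbours of [j] are measured in [Z], so the setting determines the stabilizer of [j]: it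
    is +1 on [psi] and -1 on the vector of [w]. *)
Lemma canonical_test_reject_stabilizer (B w : {set 'I_n}) j :
  j \in B -> (forall i, e j i -> i \notin B) -> j \in w ->
  canonical_test psi B *m graph_basis psi w = 0.
Proof.
move=> jB nB jw.
apply: (canonical_test_reject (A := stabilizer_factor C e j) (c := 1)).
- move=> i; rewrite /stabilizer_factor; have [->|_] := eqVneq i j.
    by right; rewrite jB.
  by case: ifP => [/nB/negbTE->|_]; [right|left].
- exact: oner_neq0.
- by rewrite -stabilizerE // psiG.2 scale1r.
by rewrite -stabilizerE // (stabilizer_graph_basis e_irr psiG) jw expr1 scaleN1r scale1r.
Qed.

Hypothesis e_even : forall j, ~~ odd #|[set i | e j i]|.
Local Notation Xall := (on_qubits [set: 'I_n] (pauliX C)).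

(* [Xall] is, up to sign, the product of all the stabilizers; computing the sign
   is avoided by showing that [Xall *m psi] is stabilized. *)
Lemma X_all_eigen : exists2 c, c != 0 & Xall *m psi = c *: psi.
Proof.
have comm j : stabilizer C e j *m Xall = Xall *m stabilizer C e j.
  rewrite stabilizerE //.
  (* [X] meets [Z] exactly on the neighbours of [j], which are even in number. *)
  rewrite (tensor_commute (c := fun i => if e j i then -1 else 1)).
    rewrite -big_mkcond /= prodr_const.
    rewrite (@eq_card _ (e j) (mem [set i | e j i])); last by move=> i; rewrite inE.
    by rewrite -signr_odd (negbTE (e_even j)) expr0 scale1r.
  move=> i; rewrite inE /stabilizer_factor; have [->|_] := eqVneq i j.
    by rewrite e_irr scale1r.
  by case: ifP => _; rewrite ?scale1r ?mulmx1 ?mul1mx // scaleN1r pauliZX.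
have Xpsi : Xall *m psi = ip psi (Xall *m psi) *: psi.
  apply: (stabilized_vector e_irr psiG) => j.
  by rewrite mulmxA comm -mulmxA psiG.2.
exists (ip psi (Xall *m psi)) => //; apply/eqP => c0; move: Xpsi.
rewrite c0 scale0r => Xpsi0; have := ip_psi psiG.
rewrite -(unitary_ip _ _ (on_qubits_unitary C true setT)) Xpsi0 ip0r => /eqP.
by rewrite eq_sym oner_eq0.
Qed.

(** [Xall] is measured by the setting of all vertices, and it anticommutes with a product of an odd
    number of [Z]. *)
Lemma canonical_test_reject_odd (w : {set 'I_n}) : odd #|w| ->
  canonical_test psi setT *m graph_basis psi w = 0.
Proof.
move=> wodd; have [c c0 Xpsi] := X_all_eigen.
apply: (canonical_test_reject
  (A := fun i => if i \in [set: 'I_n] then pauliX C else 1%:M) _ c0).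
- by move=> i; right; rewrite inE.
- exact: Xpsi.
rewrite mulmxA (tensor_commute (c := fun i => if i \in w then -1 else 1)).
  rewrite -big_mkcond /= prodr_const -signr_odd wodd expr1 scaleN1r mulNmx.
  by rewrite -mulmxA Xpsi -scalemxAr.
move=> i; rewrite inE; case: ifP => _; last by rewrite scale1r mulmx1 mul1mx.
by rewrite scaleN1r pauliXZ.
Qed.

End Rejection.

(** * Settings of the ring *)

Section Ring.
Variable n : nat.
Hypothesis n_ge3 : (3 <= n)%N.
Local Notation e := (@ring_graph n).
Implicit Types (i j k : 'I_n).

Let n_gt0 : (0 < n)%N. Proof. exact: leq_trans n_ge3. Qed.

(** Turns congruences between offsets from a common vertex into equalities. *)
Lemma modn_shift_inj (a b c : nat) : (b < n)%N -> (c < n)%N ->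
  (a + b == a + c %[mod n])%N -> b = c.
Proof. by move=> bn cn; rewrite eqn_modDl !modn_small // => /eqP. Qed.

Lemma ring_irr : irreflexive e.
Proof.
move=> i; rewrite /ring_graph orbb; apply/negbTE/eqP => /(congr1 val) /= h.
suff : 1%N = 0%N by [].
by apply: (@modn_shift_inj i) => //; rewrite ?(leq_trans _ n_ge3) //
  addn1 -h addn0 modn_small.
Qed.

(** The two neighbours are distinct because 2 is not 0 modulo [n]. *)
Lemma ring_degree j : #|[set i | e j i]| = 2%N.
Proof.
have -> : [set i | e j i] = [set ordS j; ord_pred j].
  apply/setP => i; rewrite !inE /ring_graph.
  by rewrite -(can2_eq (@ordSK n) (@ord_predK n)) (eq_sym j).
rewrite cards2; suff -> : ordS j != ord_pred j by [].
apply/eqP => /(congr1 (@ordS n)); rewrite ord_predK => /(congr1 val) /=.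
rewrite -addn1 modnDml addn1 -addn2 => h; suff : 2%N = 0%N by [].
by apply: (@modn_shift_inj j) => //; rewrite addn0 h modn_small.
Qed.

Lemma ring_settingP i j :
  reflect (exists2 k, (k.*2 <= n - 3)%N & (i == j + k.*2 %[mod n])%N)
    (i \in ring_setting j).
Proof.
rewrite inE; apply: (iffP existsP) => [[k /andP[k1 k2]]|[k k1 k2]].
  by exists k.
have kn : (k < n)%N.
  by apply: leq_ltn_trans (_ : (k.*2 < n)%N); rewrite -?addnn ?leq_addr // addnn
    (leq_ltn_trans k1) // ltn_subrL.
by exists (Ordinal kn); rewrite k1.
Qed.

(** Offsets from [j] in the setting are even and at most [n - 3]. A successor has an odd offset of
    at most [n - 2], so it does not wrap around and cannot equal an even one. *)
Lemma ring_setting_independent i i' j :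
  i \in ring_setting j -> e i i' -> i' \notin ring_setting j.
Proof.
have h l : l \in ring_setting j -> ordS l \notin ring_setting j.
  case/ring_settingP => k k1 /eqP k2; apply/negP => /ring_settingP[k' k1' k2'].
  suff /(congr1 odd) : k.*2.+1 = k'.*2 by rewrite /= !odd_double.
  apply: (@modn_shift_inj j).
  - by rewrite (leq_ltn_trans (_ : _ <= (n - 3).+1)%N) // -subSn // subSS ltn_subrL.
  - by rewrite (leq_ltn_trans k1') // ltn_subrL.
  rewrite -(eqP k2') /= modn_mod addnS -addn1 -modnDml -k2 modnDml addn1.
  exact: eqxx.
move=> ij /orP[/eqP->|/eqP ii']; first exact: h.
by apply: contraL ij => /h; rewrite -ii'.
Qed.

Hypothesis n_odd : odd n.

(** The indices of settings that measure the stabilizer of [i], hence reject every [w] containing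
    [i]. *)
Definition ring_detecting i : {set 'I_n} := [set j | i \in ring_setting j].

Lemma ring_detecting_self i : i \in ring_detecting i.
Proof. by rewrite inE; apply/ring_settingP; exists 0%N; rewrite //= addn0. Qed.

Lemma card_ring_detecting i : (n./2 <= #|ring_detecting i|)%N.
Proof.
have k2 (k : 'I_n./2) : (k.*2 <= n - 3)%N.
  have := ltn_ord k; move: n_odd; lia.
have k2n (k : 'I_n./2) : (k.*2 < n)%N.
  by apply: leq_ltn_trans (k2 k) _; rewrite ltn_subrL.
(* The index [i - 2k], with [n] added to avoid truncated subtraction. *)
pose f (k : 'I_n./2) : 'I_n := Ordinal (ltn_pmod (i + (n - k.*2)) n_gt0).
have fE (k : 'I_n./2) : (f k + k.*2 = i %[mod n])%N.
  by rewrite /= modnDml -addnA subnK ?modnDr // ltnW.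
have f_inj : injective f.
  move=> k k' ff; apply/ord_inj/double_inj; apply: (@modn_shift_inj (f k)) => //.
  by apply/eqP; rewrite (fE k) ff fE.
rewrite -{1}[n./2]card_ord -cardsT -(card_imset _ f_inj); apply/subset_leq_card.
apply/subsetP => j /imsetP[k _ ->]; rewrite inE; apply/ring_settingP.
by exists k; rewrite ?k2 // fE.
Qed.

(** The two offsets [2k] and [2k'] add up to a multiple of [n]. As [n] is odd it divides [k + k'],
    which is less than [n]; so both are zero. *)
Lemma ring_detecting_asym i i' :
  i \in ring_detecting i' -> i' \in ring_detecting i -> i = i'.
Proof.
rewrite inE => /ring_settingP[k k1 k2]; rewrite inE => /ring_settingP[k' k1' k2'].
have : (n %| (k + k').*2)%N.
  rewrite /dvdn -[X in _ == X](mod0n n) -(eqn_modDl i) addn0 doubleD addnA.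
  by rewrite -modnDml -(eqP k2) modnDml -(eqP k2').
rewrite -muln2 Gauss_dvdl ?coprimen2 // => dv.
have lt : (k + k' < n)%N.
  rewrite -ltn_double doubleD (leq_ltn_trans (leq_add k1 k1')) // -addnn.
  by rewrite (leq_ltn_trans (leq_add (leqnn _) (leq_subr _ _))) // ltn_add2r ltn_subrL.
have : (k + k' == 0)%N.
  by move: dv; rewrite /dvdn modn_small.
rewrite addn_eq0 => /andP[/eqP k0 _]; apply: ord_inj.
by move: k2; rewrite k0 addn0 !modn_small // => /eqP->.
Qed.

(** By asymmetry one of the two vertices is missing from the detecting set of the other; since it
    detects itself, it enlarges that set in the union. *)
Lemma card_ring_detecting2 i i' : i != i' ->
  (n./2 < #|ring_detecting i :|: ring_detecting i'|)%N.
Proof.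
have h l l' : l \notin ring_detecting l' ->
    (n./2 < #|ring_detecting l :|: ring_detecting l'|)%N.
  move=> ll'; apply: leq_ltn_trans (card_ring_detecting l') _.
  apply/proper_card/properP; split; first exact: subsetUr.
  by exists l => //; rewrite inE ring_detecting_self.
move=> ii'; have [h1|/h//] := boolP (i \in ring_detecting i').
have [h2|/h] := boolP (i' \in ring_detecting i); last by rewrite setUC.
by rewrite (ring_detecting_asym h1 h2) eqxx in ii'.
Qed.

(** A nonempty [w] of even cardinality contains two vertices, whence the extra unit; for odd
    cardinality the setting of all vertices will supply it. *)
Lemma card_ring_detecting_set (w : {set 'I_n}) : w != set0 ->
  (n./2 + ~~ odd #|w| <= #|\bigcup_(i in w) ring_detecting i|)%N.
Proof.
move=> w0; case: (boolP (odd #|w|)) => ow.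
  case/set0Pn: w0 => i iw; rewrite addn0; apply: leq_trans (card_ring_detecting i) _.
  exact/subset_leq_card/bigcup_sup.
have : (1 < #|w|)%N.
  by move: w0 ow; rewrite -card_gt0; case: #|w| => [|[]].
case/card_gt1P => i [i' [iw i'w /card_ring_detecting2 h]]; rewrite addn1.
apply: leq_trans h _; apply/subset_leq_card.
by rewrite subUset !bigcup_sup.
Qed.

End Ring.

(** * Tests attaining the gap on the ring *)

Section RingVerification.
Variables (R : realType) (n : nat).
Hypothesis n_ge3 : (3 <= n)%N.
Local Notation e := (@ring_graph n).
Variable psi : 'cV[R[i]]_(qdim n).
Hypothesis psiG : graph_state e psi.

Definition parity_setting (b : bool) : {set 'I_n} := [set i : 'I_n | odd i == b].

(** For even [n] parity alternates all around the ring, so each class is independent, and the class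
    of any vertex of [w] rejects [w]: one setting out of two. *)
Lemma parity_test_beta : ~~ odd n -> beta (uniform_test psi parity_setting) <= 1 / 2.
Proof.
move=> n_even; have e_irr := ring_irr n_ge3.
apply: (uniform_test_beta e_irr psiG); first by rewrite card_bool.
move=> w /set0Pn[j jw]; rewrite card_bool leq_pmulr //; apply/card_gt0P.
exists (odd j); apply/eqP.
apply: (canonical_test_reject_stabilizer e_irr psiG (j := j)) => //.
  by rewrite inE.
move=> i ji; rewrite inE.
have h (l l' : 'I_n) : l' == ordS l -> odd l' = ~~ odd l.
  by move/eqP->; rewrite /= odd_mod // (negbTE n_even).
by case/orP: ji => /h ->; case: odd.
Qed.

(** Index [ord0] is the setting of all vertices, and [lift ord0 j] the ring setting of [j]. *)
Definition extended_ring_setting (k : 'I_n.+1) : {set 'I_n} :=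
  if unlift ord0 k is Some j then ring_setting j else setT.

Lemma sum_extended_ring_setting (V : zmodType) (F : {set 'I_n} -> V) :
  \sum_k F (extended_ring_setting k) = \sum_j F (ring_setting j) + F setT.
Proof.
rewrite (bigD1_ord ord0) //= addrC /extended_ring_setting unlift_none.
by congr (_ + _); apply: eq_bigr => j _; rewrite liftK.
Qed.

Lemma ring_verificationE :
  ring_verification psi = uniform_test psi extended_ring_setting.
Proof.
by rewrite /uniform_test card_ord (sum_extended_ring_setting (canonical_test psi)).
Qed.

Lemma ring_verification_beta : odd n -> beta (ring_verification psi) <= 1 / 2.
Proof.
move=> n_odd; have e_irr := ring_irr n_ge3; rewrite ring_verificationE.
apply: (uniform_test_beta e_irr psiG); first by rewrite card_ord.
move=> w w0; set rej := [pred k | _].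
pose D := \bigcup_(i in w) ring_detecting i.
have rejD : {subset [set lift ord0 j | j in D] <= rej}.
  move=> k /imsetP[j /bigcupP[i iw]]; rewrite inE => ij ->; apply/eqP.
  rewrite /extended_ring_setting liftK.
  apply: (canonical_test_reject_stabilizer e_irr psiG (j := i)) => // l.
  exact: ring_setting_independent.
have cardD : #|[set lift ord0 j | j in D]| = #|D| by apply/card_imset/lift_inj.
(* For odd [n] this is exactly half of the [n.+1] settings. *)
have : (n./2.+1 <= #|rej|)%N.
  have hD := card_ring_detecting_set n_ge3 n_odd w0.
  case: (boolP (odd #|w|)) hD => ow; rewrite ?addn0 ?addn1 => hD; last first.
    apply: leq_trans hD _; rewrite -/D -cardD; apply/subset_leq_card/subsetP.
    exact: rejD.
  (* For [w] of odd cardinality the missing unit is the index [ord0]. *)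
  apply: leq_trans (_ : (#|ord0 |: [set lift ord0 j | j in D]| <= _)%N).
    rewrite cardsU1 cardD (_ : ord0 \notin _) ?add1n //.
    by apply/imsetP => -[j _ /eqP]; rewrite (negbTE (neq_lift _ _)).
  apply/subset_leq_card/subsetP => k; rewrite inE => /orP[|/rejD//].
  rewrite inE => /eqP->; apply/eqP; rewrite /extended_ring_setting unlift_none.
  by apply: (canonical_test_reject_odd e_irr psiG) => // j; rewrite ring_degree.
rewrite card_ord mul2n -leq_double; apply: leq_trans.
by rewrite doubleS -{1}(odd_double_half n) n_odd.
Qed.

End RingVerification.

Theorem mainTheorem3 (R : realType) (n : nat) (hn : (3 <= n)%N)
    (psi : 'cV[R[i]]_(qdim n)) (hpsi : graph_state (@ring_graph n) psi) :
  [/\ exists Omega, XZ_verification psi Omega /\ nu Omega = 1 / 2,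
      forall Omega, XZ_verification psi Omega -> nu Omega <= 1 / 2
    & odd n ->
      XZ_verification psi (ring_verification psi) /\
      nu (ring_verification psi) = 1 / 2].
Proof.
have upper Omega : XZ_verification psi Omega -> nu Omega <= 1 / 2.
  have n_gt0 : (0 < n)%N := leq_trans (isT : 0 < 3)%N hn.
  have edge (j : 'I_n) : ring_graph j (ordS j) by rewrite /ring_graph eqxx.
  exact: (XZ_nu_le_half (ring_irr hn) hpsi (edge (Ordinal n_gt0))).
(* Given the upper bound on the gap, optimality reduces to an upper bound on [beta]. *)
have optimal Omega : XZ_verification psi Omega -> beta Omega <= 1 / 2 ->
    XZ_verification psi Omega /\ nu Omega = 1 / 2.
  move=> XZ b; split=> //; apply/le_anti; rewrite upper //=.
  by rewrite /nu lerBrDr -lerBrDl {1}[1]splitr addrK.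
have odd_case : odd n -> XZ_verification psi (ring_verification psi) /\
    nu (ring_verification psi) = 1 / 2.
  move=> n_odd; apply: optimal; last exact: ring_verification_beta.
  by rewrite ring_verificationE; apply: uniform_test_XZ; rewrite card_ord.
split=> //; case: (boolP (odd n)) => [/odd_case h|n_even].
  by exists (ring_verification psi).
exists (uniform_test psi (@parity_setting n)); apply: optimal.
  by apply: uniform_test_XZ; rewrite card_bool.
exact: parity_test_beta.
Qed.
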